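(* Let $p\ge 2$ be a prime and let $\mathbb{H}=(\mathbb{Z}/p\mathbb{Z})/G$ be the quotient hyperfield with $G\subseteq(\mathbb{Z}/p\mathbb{Z})^\times$ a subgroup with $|G|=1$. Then $\operatorname{gen}(\mathbb{H})=\{p\}$.
   Context: Let $p$ be a prime and $G$ a subgroup of $(\mathbb{Z}/p\mathbb{Z})^\times$ of size $n$. The $(p,n)$-hyperfield $\mathbb{H}=(\mathbb{Z}/p\mathbb{Z})/G$ has as elements the orbits $[a]=\{ga: g\in G\}$, $a\in\mathbb{Z}/p\mathbb{Z}$; multiplication is $[a]\odot[b]=[ab]$, and the multivalued hyperaddition is $[a]\boxplus[b]=\{[c] : [c]\subseteq\{x+y : x\in[a],\ y\in[b]\}\}$, extended to non-empty subsets $A,B$ of $\mathbb{H}$ by $A\boxplus B=\bigcup_{\alpha\in A,\beta\in B}(\alpha\boxplus\beta)$. The zero element is $0=[0]$. For a natural number $k$ and $x\in\mathbb{H}$, $kx$ denotes the set $x\boxplus x\boxplus\cdots\boxplus x$ with $k$ copies of $x$ (the empty sum being $\{0\}$). The characteristic $\operatorname{char}(\mathbb{H})$ is the additive submonoid (containing $0$) of all natural numbers $k$ such that $0\in kx$ for all $x\in\mathbb{H}$. The generating set $\operatorname{gen}(\mathbb{H})$ is the finite set $\{g_1,\dots,g_r\}$ of distinct natural numbers of minimal cardinality such that $\operatorname{char}(\mathbb{H})=\{g_1x_1+\cdots+g_rx_r : x_i\in\mathbb{Z}_{\ge0}\}$. *)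

(* Defs.v *)
From mathcomp Require Import all_boot all_order all_algebra all_fingroup.
From mathcomp Require Import finmap.

Set Implicit Arguments.
Unset Strict Implicit.
Unset Printing Implicit Defensive.

Import GRing.Theory.
Local Open Scope ring_scope.

Section QuotientHyperfield.

(* 'F_p is Z/pZ when p is prime; this is the only case of interest. *)
Variables (p : nat) (G : {group {unit 'F_p}}).

(* ['U] is the action of the units by multiplication, so [orb a] is the set
   of all a * g with g in G. *)
Definition orb (a : 'F_p) : {set 'F_p} := orbit 'U%act G a.

Definition hyperfield : Type := {A : {set 'F_p} | A \in [set orb a | a : 'F_p]}.

Fact orb_subproof (a : 'F_p) : orb a \in [set orb b | b : 'F_p].
Proof. exact: imset_f. Qed.

Definition cls (a : 'F_p) : hyperfield := exist _ (orb a) (orb_subproof a).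

Definition hzero : hyperfield := cls 0.

(* The product is computed on chosen representatives; [hmulE] shows that
   the choice is irrelevant. *)
Definition hrepr (x : hyperfield) : 'F_p := odflt 0 [pick a in val x].

Definition hmul (x y : hyperfield) : hyperfield := cls (hrepr x * hrepr y).

Lemma hmulE (a b : 'F_p) : hmul (cls a) (cls b) = cls (a * b).
Proof.
have rP c : exists2 g, g \in G & hrepr (cls c) = c * val g.
  rewrite /hrepr /=; case: pickP => [d /imsetP[g Gg ->]|/(_ c)].
    by exists g.
  by rewrite /orb orbit_refl.
rewrite /hmul; have [g Gg ->] := rP a; have [h Gh ->] := rP b.
apply: val_inj; apply/orbit_eqP; apply/imsetP.
by exists (g * h)%g; [exact: groupM | rewrite /= /FinRing.unit_act mulrACA].
Qed.

Definition hadd (x y : hyperfield) : {set hyperfield} :=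
  [set z : hyperfield | val z \subset [set u + v | u in val x, v in val y]].

Definition hadds (A B : {set hyperfield}) : {set hyperfield} :=
  \bigcup_(x in A) \bigcup_(y in B) hadd x y.

(* k copies of x, nested to the right; [set hzero] when k = 0. *)
Definition hmuln (k : nat) (x : hyperfield) : {set hyperfield} :=
  iterop k hadds [set x] [set hzero].

Definition hchar : pred nat := fun k => [forall x, hzero \in hmuln k x].

End QuotientHyperfield.

Definition generates (s : {fset nat}) (M : pred nat) : Prop :=
  forall n : nat,
    M n <-> exists c : nat -> nat, n = (\sum_(g <- s) g * c g)%N.

Definition is_gen (p : nat) (G : {group {unit 'F_p}}) (s : {fset nat}) : Prop :=
  generates s (hchar G) /\
  forall t : {fset nat}, generates t (hchar G) -> (#|` s| <= #|` t|)%N.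

(* Main.v *)
Require Import Defs.
From mathcomp Require Import all_boot all_order all_algebra all_fingroup.
From mathcomp Require Import finmap.

Import GRing.Theory.

Local Open Scope fset_scope.

(** When [G] is trivial, orbits are singletons, so the hyperfield is just the field ['F_p] with
    single-valued addition ([hadd_trivg]), and [k] copies of a class add up to one class
    ([hmuln_trivg]). Hence [k] lies in the characteristic exactly when [k] vanishes in ['F_p], that
    is, when [p] divides [k] ([hchar_trivg]). The multiples of [p] need at least one generator, and
    a single one must be [p]. *)

Section TrivialSubgroup.

Variables (p : nat) (G : {group {unit 'F_p}}).
Hypothesis cardG : #|G| = 1%N.

Lemma orb_trivg (a : 'F_p) : orb G a = [set a].
Proof.
rewrite /orb (card1_trivg cardG); apply/setP=> b; rewrite inE.
apply/imsetP/eqP=> [[g /set1P-> ->]|->]; first exact: act1.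
by exists 1%g; rewrite ?set11 ?act1.
Qed.

Lemma cls_inj_trivg : injective (@cls p G).
Proof. by move=> a b /(congr1 val); rewrite /= !orb_trivg => /set1_inj. Qed.

Lemma hadd_trivg (a b : 'F_p) : hadd (cls G a) (cls G b) = [set cls G (a + b)%R].
Proof.
apply/setP=> z; rewrite !inE /= !orb_trivg imset2_set1l imset_set1.
have /imsetP[c _ zE] := valP z.
have -> : z = cls G c by apply: val_inj.
by rewrite /= orb_trivg sub1set inE (inj_eq cls_inj_trivg).
Qed.

Lemma hmuln_trivg (k : nat) (a : 'F_p) : hmuln k (cls G a) = [set cls G (a *+ k)%R].
Proof.
case: k => [|k]; first by rewrite mulr0n.
(* [iterop] uses its neutral element only for zero copies, so the induction starts from a single
   copy. *)
rewrite /hmuln iteropS; elim: k => [|k IHk] //=.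
by rewrite IHk /hadds !big_set1 hadd_trivg -mulrS.
Qed.

Lemma hchar_trivg (p_prime : prime p) (k : nat) : hchar G k = (p %| k).
Proof.
rewrite (dvdn_pcharf (pchar_Fp p_prime)).
have in_muln a : (hzero G \in hmuln k (cls G a)) = (a *+ k == 0)%R.
  by rewrite hmuln_trivg inE (inj_eq cls_inj_trivg) eq_sym.
apply/forallP/idP=> [/(_ (cls G 1%R))|/eqP k0 x]; first by rewrite in_muln.
have /imsetP[a _ xE] := valP x.
have -> : x = cls G a by apply: val_inj.
by rewrite in_muln -mulr_natr k0 mulr0.
Qed.

End TrivialSubgroup.

Lemma generates_fset1 (g : nat) (M : pred nat) :
  generates [fset g] M <-> M =1 dvdn g.
Proof.
split=> [gM n|gM n]; last first.
  rewrite gM; split=> [/dvdnP[q ->]|[c ->]].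
    by exists (fun=> q); rewrite big_seq_fset1 mulnC.
  by rewrite big_seq_fset1 dvdn_mulr.
apply/idP/idP=> [/gM[c ->]|/dvdnP[q ->]]; first by rewrite big_seq_fset1 dvdn_mulr.
by apply/gM; exists (fun=> q); rewrite big_seq_fset1 mulnC.
Qed.

(** An empty family yields only the empty sum 0. *)
Lemma generates_card_gt0 (t : {fset nat}) (M : pred nat) (n : nat) :
  generates t M -> M n -> 0 < n -> 0 < #|` t|.
Proof.
move=> tM /tM[c ->]; apply: contraTT; rewrite -!eqn0Ngt => /eqP/cardfs0_eq->.
by rewrite big_seq_fset0.
Qed.

Theorem theorem6 (p : nat) (p_prime : prime p) (G : {group {unit 'F_p}})
    (cardG : #|G| = 1%N) (s : {fset nat}) :
  is_gen G s <-> s = [fset p].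
Proof.
have charE := hchar_trivg p G cardG p_prime.
have p_gen : generates [fset p] (hchar G) by apply/generates_fset1.
have card_gt0 t : generates t (hchar G) -> 0 < #|` t|.
  by move=> /generates_card_gt0/(_ _ (prime_gt0 p_prime)); apply; rewrite charE.
split=> [[s_gen s_min]|->]; last first.
  by split=> // t /card_gt0; rewrite cardfs1.
have : #|` s| == 1.
  (* Minimality is tested against the competitor [[fset p]]. *)
  by rewrite eqn_leq card_gt0 // andbT -(cardfs1 p) s_min.
case/cardfs1P=> g sE; rewrite sE in s_gen *; move/generates_fset1: s_gen => gE.
(* [g] and [p] have the same multiples, hence divide each other. *)
by congr [fset _]; apply/eqP; rewrite eqn_dvd -!gE !charE dvdnn -charE gE dvdnn.
Qed.
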